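(* For a finite loopless binary matroid $M$, the following are equivalent. (1) $M$ admits a nice partition. (2) $M$ is simple and supersolvable. If these conditions hold, every nice partition of $M$ is induced by a maximal chain of modular flats; that is, up to reordering, its blocks are the successive differences $X_i\setminus X_{i-1}$ of a chain $\varnothing=X_0\subsetneq X_1\subsetneq\cdots\subsetneq X_r=E(M)$ of modular flats of $M$ with $\operatorname{rk}_M(X_i)=i$, where $r$ is the rank of $M$.
   Context: A matroid is binary if it is representable over $\mathbb F_2$. $\operatorname{cl}_M$ and $\operatorname{rk}_M$ denote closure and rank. Two flats $X,Y$ of $M$ form a modular pair if $\operatorname{rk}_M(X)+\operatorname{rk}_M(Y)=\operatorname{rk}_M(X\cap Y)+\operatorname{rk}_M(\operatorname{cl}_M(X\cup Y))$; a flat is modular if it forms a modular pair with every flat of $M$. A rank-$r$ matroid is supersolvable if it has a chain $\operatorname{cl}_M(\varnothing)=X_0\subsetneq X_1\subsetneq\cdots\subsetneq X_r=E(M)$ of modular flats with $\operatorname{rk}_M(X_i)=i$. A partition $\pi=(\pi_1,\dots,\pi_s)$ of $E(M)$ into nonempty blocks is independent if every transversal $\{e_1,\dots,e_s\}$ with $e_i\in\pi_i$ is independent in $M$. It is nice if it is independent and, for every nonempty flat $F$, the partition of $F$ induced by $\pi$ (whose blocks are the nonempty sets $\pi_i\cap F$) has a singleton block. If $E(M)=\varnothing$, the empty partition is nice. *)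

(* Defs.v *)
From HB Require Import structures.
From mathcomp Require Import all_boot all_order all_algebra.

Set Implicit Arguments.
Unset Strict Implicit.
Unset Printing Implicit Defensive.

(* The ground set E(M) is the whole finite type T, i.e. [set: T]. *)
Record matroid (T : finType) := Matroid {
  indep : pred {set T};
  indep_set0 : indep set0;
  indep_subset : forall I J : {set T}, I \subset J -> indep J -> indep I;
  indep_augment : forall I J : {set T}, indep I -> indep J -> #|I| < #|J| ->
    exists2 x, x \in J :\: I & indep (x |: I)
}.

Section Matroid.
Variables (T : finType) (M : matroid T).
Implicit Types (A X Y F B : {set T}) (P : {set {set T}}).

Definition rk A : nat := \max_(I : {set T} | (I \subset A) && indep M I) #|I|.

Definition cl A : {set T} := [set x | rk (x |: A) == rk A].

Definition flat F : Prop := cl F = F.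

(* The seq [seq v x | x <- enum A] keeps repetitions, so that distinct elements
   with equal vectors are parallel, and elements with zero vector are loops. *)
Definition representable (K : fieldType) : Prop :=
  exists (n : nat) (v : T -> 'rV[K]_n),
    forall A, indep M A = free [seq v x | x <- enum A].

Definition binary : Prop := representable 'F_2.

Definition loopless : Prop := forall x, indep M [set x].

Definition simple_matroid : Prop :=
  loopless /\ forall x y, x != y -> indep M [set x; y].

Definition modular_pair X Y : Prop :=
  rk X + rk Y = rk (X :&: Y) + rk (cl (X :|: Y)).

Definition modular_flat X : Prop :=
  flat X /\ forall Y, flat Y -> modular_pair X Y.

(* Only the values X 0, ..., X (rk [set: T]) are relevant. *)
Definition maximal_modular_chain (X : nat -> {set T}) : Prop :=
  [/\ X 0 = cl set0,
      X (rk [set: T]) = [set: T],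
      forall i, i < rk [set: T] -> X i \proper X i.+1
    & forall i, i <= rk [set: T] -> modular_flat (X i) /\ rk (X i) = i].

Definition supersolvable : Prop :=
  exists X : nat -> {set T}, maximal_modular_chain X.

Definition independent_partition P : Prop :=
  partition P [set: T] /\
  forall A, is_transversal A P [set: T] -> indep M A.

Definition nice_partition P : Prop :=
  independent_partition P /\
  forall F, flat F -> F != set0 -> exists2 B, B \in P & #|B :&: F| = 1.

End Matroid.

(* Main.v *)
(* Work with vectors over F_2.  Every flat F meets exactly rk F blocks of a nice
   partition, so a line through two elements of one block contains a third
   element, in another block, which must be their sum.  For a union of blocks that
   is a flat, expand its elements in a transversal basis and draw an edge C -> B
   if an element of C has a nonzero coordinate at B: a chordless cycle would
   yield a dependent transversal, so some block receives no edge, and deleting it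
   leaves a hyperplane.  That hyperplane is modular, as the sum of any two deleted
   elements lies in it; iterating produces the chain.  Conversely, the successive
   differences of a modular chain form a nice partition: if X_i is the first member
   of the chain to meet F, a line spanned by two elements of F :&: X_i would meet
   the modular flat X_(i-1). *)
Require Import Defs.
From HB Require Import structures.
From mathcomp Require Import all_boot all_order all_algebra.

Set Implicit Arguments.
Unset Strict Implicit.
Unset Printing Implicit Defensive.

Import GRing.Theory.

(** * Rank, closure and modularity as linear algebra over an arbitrary field *)

Section Representation.
Variables (T : finType) (M : matroid T) (K : fieldType) (n : nat).
Variable v : T -> 'rV[K]_n.
Hypothesis Mv : forall A, indep M A = free [seq v x | x <- enum A].
Implicit Types (A B I F X Y : {set T}) (x y : T) (U : {vspace 'rV[K]_n}).

(** Generated by the very sequence whose freeness defines [indep], so that independence becomes an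
    equality between dimension and cardinality. *)
Definition vspan A : {vspace 'rV[K]_n} := <<[seq v x | x <- enum A]>>%VS.

Lemma mem_vspan A x : x \in A -> v x \in vspan A.
Proof. by move=> Ax; apply/memv_span/map_f; rewrite mem_enum. Qed.

Lemma vspan_subvP A U :
  reflect (forall x, x \in A -> v x \in U) (vspan A <= U)%VS.
Proof.
apply: (iffP span_subvP) => [sAU x Ax | sAU _ /mapP[x Ax ->]].
  by apply/sAU/map_f; rewrite mem_enum.
by apply: sAU; rewrite mem_enum in Ax.
Qed.

Lemma vspanS A B : A \subset B -> (vspan A <= vspan B)%VS.
Proof. by move/subsetP=> sAB; apply/vspan_subvP=> x /sAB/mem_vspan. Qed.

Lemma vspanU A B : vspan (A :|: B) = (vspan A + vspan B)%VS.
Proof.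
apply: subv_anti; rewrite subv_add !vspanS ?subsetUl ?subsetUr // !andbT.
apply/vspan_subvP=> x /setUP[/mem_vspan | /mem_vspan].
  by apply/subvP; rewrite addvSl.
by apply/subvP; rewrite addvSr.
Qed.

Lemma vspan1 x : vspan [set x] = <[v x]>%VS.
Proof. by rewrite /vspan enum_set1 span_seq1. Qed.

Lemma vspan0 : vspan set0 = 0%VS.
Proof. by rewrite /vspan enum_set0 span_nil. Qed.

Lemma vspanU1 x A : vspan (x |: A) = (<[v x]> + vspan A)%VS.
Proof. by rewrite vspanU vspan1. Qed.

Lemma indepE A : indep M A = (\dim (vspan A) == #|A|).
Proof. by rewrite Mv /free size_map cardE. Qed.

Lemma indepU1 x I :
  x \notin I -> indep M (x |: I) = (v x \notin vspan I) && indep M I.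
Proof.
move=> xI; rewrite !Mv -free_cons.
have /(perm_map v)/perm_free-> // : perm_eq (enum (x |: I)) (x :: enum I).
apply: uniq_perm; rewrite /= ?enum_uniq ?mem_enum ?xI //.
by move=> y; rewrite in_cons !mem_enum in_setU1.
Qed.

(** A maximal independent subset [I] of [A] already spans [A]: an element of [A] outside the span of
    [I] could be added to it. *)
Lemma rkE A : rk M A = \dim (vspan A).
Proof.
apply/eqP; rewrite eqn_leq; apply/andP; split.
  apply/bigmax_leqP=> I /andP[sIA]; rewrite indepE => /eqP <-.
  by rewrite dimvS ?vspanS.
have [I /maxsetP[/andP[sIA iI] maxI] _] :
  {I | maxset (fun J => (J \subset A) && indep M J) I & set0 \subset I}.
  by apply: maxset_exists; rewrite sub0set indep_set0.
have /dimvS/leq_trans-> // : (vspan A <= vspan I)%VS.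
  apply/vspan_subvP=> x Ax; have [/mem_vspan // | xI] := boolP (x \in I).
  apply: contraNT (xI) => vx; suff <- : x |: I = I by rewrite setU11.
  apply: maxI; last by rewrite subsetUr.
  by rewrite subUset sub1set Ax sIA indepU1 ?vx.
have := iI; rewrite indepE => /eqP->.
by rewrite (bigmax_sup I) // sIA.
Qed.

Lemma clE A x : (x \in cl M A) = (v x \in vspan A).
Proof.
rewrite inE !rkE vspanU1 eq_sym (dimv_leqif_sup (addvSr _ _)).
by rewrite subv_add subvv andbT -memvE.
Qed.

Lemma flatP F : reflect (forall x, v x \in vspan F -> x \in F) (cl M F == F).
Proof.
apply: (iffP eqP) => [clF x | clF]; first by rewrite -clE clF.
by apply/setP=> x; rewrite clE; apply/idP/idP=> [/clF | /mem_vspan].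
Qed.

Lemma vspan_cl A : vspan (cl M A) = vspan A.
Proof.
apply: subv_anti; apply/andP; split; apply/vspan_subvP=> x; first by rewrite clE.
by move=> Ax; apply: mem_vspan; rewrite clE mem_vspan.
Qed.

Lemma flat_cl A : flat M (cl M A).
Proof. by apply/setP=> x; rewrite !clE vspan_cl. Qed.

(** By the dimension formula for sums, modularity says that [vspan (X :&: Y)] and the larger space
    [vspan X :&: vspan Y] have equal dimensions; only one inclusion is then at stake. *)
Lemma modular_pairE X Y :
  modular_pair M X Y <-> (vspan X :&: vspan Y <= vspan (X :&: Y))%VS.
Proof.
rewrite /modular_pair !rkE vspan_cl vspanU.
have sI : (vspan (X :&: Y) <= vspan X :&: vspan Y)%VS.
  by rewrite subv_cap !vspanS ?subsetIl ?subsetIr.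
rewrite -dimv_sum_cap [RHS in _ = RHS]addnC.
split=> [/addnI eqd | sXY].
  by rewrite -(geq_leqif (dimv_leqif_sup sI)) eqd.
by congr (_ + _); apply/eqP; rewrite eqn_leq !dimvS.
Qed.

(** * From a chain of modular flats to a nice partition *)

Section ModularChain.
Variable X : nat -> {set T}.
Hypothesis Msimple : simple_matroid M.
Hypothesis chainX : maximal_modular_chain M X.
Let r := rk M [set: T].
Let D i := X i.+1 :\: X i.

Lemma loopless_cl0 : loopless M -> cl M set0 = set0.
Proof.
move=> loopM; apply/setP=> x; rewrite clE vspan0 memv0 inE.
by have := loopM x; rewrite indepE vspan1 dim_vline cards1 eqb1 => /negPf.
Qed.

Lemma chain0 : X 0 = set0.
Proof. by case: chainX => ->; case: Msimple => /loopless_cl0. Qed.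

Lemma chain_mono i j : i <= j <= r -> X i \subset X j.
Proof.
case/andP; elim: j => [|j IHj]; first by rewrite leqn0 => /eqP->.
rewrite leq_eqVlt ltnS => /predU1P[-> // | leij ltjr].
case: chainX => _ _ propX _; have /proper_sub := propX j ltjr.
by apply: subset_trans; apply: IHj => //; apply: ltnW.
Qed.

Lemma chain_diff_inj (i j : 'I_r) x : x \in D i -> x \in D j -> i = j.
Proof.
have chain_diff_lt (k l : 'I_r) : k < l -> x \in D k -> x \notin D l.
  move=> ltkl /setDP[xk _]; rewrite inE (subsetP (chain_mono _) _ xk) //.
  by rewrite ltkl ltnW.
move=> xi xj; apply/val_inj; case: (ltngtP i j) => // [ltij | ltji].
  by have := chain_diff_lt i j ltij xi; rewrite xj.
by have := chain_diff_lt j i ltji xj; rewrite xi.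
Qed.

(* The least [i] with [X i] meeting [F], shifted by one since [X 0] is empty. *)
Lemma chain_level F : F != set0 ->
  exists i : 'I_r, X i :&: F = set0 /\ exists x, x \in D i :&: F.
Proof.
case/set0Pn=> x0 Fx0.
have exP : exists k, X k :&: F != set0.
  by exists r; apply/set0Pn; exists x0; case: chainX => _ -> _ _; rewrite !inE.
case: (ex_minnP exP) => [[|k]]; first by rewrite chain0 set0I eqxx.
case/set0Pn=> x /setIP[xk Fx] mink.
have Xk0 : X k :&: F = set0 by apply: contraTeq (ltnSn k) => /mink; rewrite -leqNgt.
have ltkr : k < r.
  by apply: mink; apply/set0Pn; exists x; case: chainX => _ -> _ _; rewrite !inE.
exists (Ordinal ltkr); split=> //; exists x; rewrite !inE xk Fx !andbT.
by apply/negP=> xk'; have := in_set0 x; rewrite -Xk0 inE xk' Fx.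
Qed.

Lemma chain_partition : partition [set D i | i : 'I_r] [set: T].
Proof.
apply/and3P; split.
- rewrite eqEsubset subsetT /=; apply/subsetP=> x _.
  have /chain_level[i [_ [y]]] : [set x] != set0 by apply/set0Pn; exists x; rewrite inE.
  rewrite in_setI in_set1 => /andP[Dy /eqP eyx]; rewrite eyx in Dy.
  by apply/bigcupP; exists (D i) => //; apply: imset_f.
- apply/trivIsetP=> _ _ /imsetP[i _ ->] /imsetP[j _ ->].
  apply: contraR => /pred0Pn[x /andP[/= xi xj]].
  by rewrite (chain_diff_inj xi xj).
- apply/negP=> /imsetP[i _ /esym /eqP]; rewrite setD_eq0.
  by case: chainX => _ _ /(_ i (ltn_ord i)) /andP[_ /negP].
Qed.

(** A transversal is built up along the chain: its element in [D i] avoids the flat [X i], hence the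
    span of the elements already chosen inside [X i]. *)
Lemma chain_independent : independent_partition M [set D i | i : 'I_r].
Proof.
split=> [|A /and3P[_ _ /forallP trA]]; first exact: chain_partition.
case: (chainX) => _ Xr _ modX.
suff indA i : i <= r -> indep M (A :&: X i).
  by have := indA r (leqnn r); rewrite Xr setIT.
elim: i => [_|i IHi ltir]; first by rewrite chain0 setI0 indep_set0.
have /cards1P[x defx] : #|A :&: D i| == 1.
  by apply: (implyP (trA _)); apply/imsetP; exists (Ordinal ltir).
have /setIP[Ax /setDP[xi' xi]] : x \in A :&: D i by rewrite defx set11.
have sXi : X i \subset X i.+1 by apply: chain_mono; rewrite leqnSn.
have -> : A :&: X i.+1 = x |: (A :&: X i).
  rewrite -defx -setIUr; congr (_ :&: _); apply/setP=> y; rewrite !inE.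
  by case: (boolP (y \in X i)) => [/(subsetP sXi)-> | _]; rewrite ?orbF.
rewrite indepU1 ?inE ?(negPf xi) ?andbF // IHi ?andbT 1?ltnW //.
have [[/eqP/flatP flX _] _] := modX i (ltnW ltir).
apply: contra xi => vx; apply: flX.
by apply: subvP vx; apply: vspanS; apply: subsetIr.
Qed.

Lemma chain_nice : nice_partition M [set D i | i : 'I_r].
Proof.
split=> [|F flF F0]; first exact: chain_independent.
have [i [XF0 [e Fe]]] := chain_level F0.
case: (chainX) => _ _ _ modX.
exists (D i); first exact: imset_f.
apply/eqP/cards1P; exists e; apply/setP=> f; rewrite in_set1.
apply/idP/eqP=> [Ff | -> //].
apply/eqP; apply: contraT => nfe.
pose L := cl M [set e; f].
have dimL : \dim (vspan L) = 2.
  have := cards2 e f; rewrite eq_sym nfe vspan_cl => <-.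
  by apply/eqP; rewrite -indepE; case: Msimple => _; apply; rewrite eq_sym.
have sLF : L \subset F.
  apply/subsetP=> x; rewrite clE => vx; apply: (flatP _ (introT eqP flF)).
  apply: subvP vx; apply: vspanS; rewrite subUset !sub1set.
  by move: Fe Ff; rewrite !in_setI => /andP[_ ->] /andP[_ ->].
have [[_ modXi] rkXi] := modX i (ltnW (ltn_ord i)).
have [_ rkXi1] := modX i.+1 (ltn_ord i).
have /modular_pairE := modXi L (flat_cl _).
have -> : X i :&: L = set0 by apply/eqP; rewrite -subset0 -XF0 setIS.
rewrite vspan0 subv0 => /eqP cap0.
have := dimv_sum_cap (vspan (X i)) (vspan L).
rewrite cap0 dimv0 addn0 dimL -rkE rkXi => dimU.
(* The spans of [X i] and [L] meet trivially, so their sum has dimension [i + 2]; yet both lie in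
   the span of [X i.+1], of dimension [i.+1]. *)
suff : i + 2 <= i.+1 by rewrite addn2 ltnn.
rewrite -[leqRHS]rkXi1 rkE -dimU dimvS // subv_add vspanS ?chain_mono ?leqnSn //=.
rewrite vspan_cl; apply: vspanS; rewrite subUset !sub1set.
by move: Fe Ff; rewrite !inE => /andP[/andP[_ ->] _] /andP[/andP[_ ->] _].
Qed.

End ModularChain.

End Representation.

(* In a minimal nonempty [S] each vertex of which has a predecessor in [S], every
   choice of predecessors permutes [S]; altering a choice at one vertex
   would break injectivity, so predecessors are unique. *)
Lemma exists_chordless_cycles (I : finType) (e : rel I) (Q : {set I}) :
    Q != set0 -> (forall i, i \in Q -> exists2 j, j \in Q & e j i) ->
  exists S : {set I}, exists p : I -> I,
  [/\ S != set0, S \subset Q, p @: S = S,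
      forall i, i \in S -> e (p i) i
    & forall i j, i \in S -> j \in S -> e j i -> j = p i].
Proof.
move=> Q0 predQ.
pose closed (S : {set I}) :=
  (S != set0) && [forall i in S, exists j in S, e j i].
have closedQ : closed Q.
  rewrite /closed Q0; apply/forall_inP=> i /predQ[j Qj eji].
  by apply/exists_inP; exists j.
have [S /minsetP[/andP[S0 /forall_inP predS] minS] sSQ] := minset_exists closedQ.
have permS (p : I -> I) : (forall i, i \in S -> (p i \in S) && e (p i) i) ->
  p @: S = S.
  move=> pS; have spS : p @: S \subset S.
    by apply/subsetP=> _ /imsetP[i Si ->]; case/andP: (pS i Si).
  apply: minS => //; apply/andP; split.
    by case/set0Pn: S0 => i Si; apply/set0Pn; exists (p i); apply: imset_f.
  apply/forall_inP=> i /(subsetP spS) Si; apply/exists_inP; exists (p i).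
    exact: imset_f.
  by case/andP: (pS i Si).
have [p pS] : exists p : I -> I, forall i, i \in S -> (p i \in S) && e (p i) i.
  apply: (@fin_all_exists _ (fun _ => I) (fun i j => i \in S -> (j \in S) && e j i)) => i.
  case: (boolP (i \in S)) => [/predS/exists_inP[j Sj eji] | _]; last by exists i.
  by exists j; rewrite Sj.
exists S, p; split=> // [|i /pS/andP[] // | i j Si Sj eji]; first exact: permS.
apply/eqP; apply: contraT => npij.
(* Since [j = p k] for some [k] other than [i], redirecting [i] to [j] makes [i] and [k] collide. *)
pose p' := [eta p with i |-> j].
have p'S : p' @: S = S.
  by apply: permS => k Sk /=; case: eqP => [-> | _]; rewrite ?Sj //; apply: pS.
have inj_p' : {in S &, injective p'} by apply/imset_injP; rewrite p'S.
move: (Sj); rewrite -{1}(permS p pS) => /imsetP[k Sk def_j].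
have nki : k != i by apply: contraNneq npij => <-; rewrite def_j.
case/eqP: (nki); apply: inj_p' => //=.
by rewrite eqxx (negPf nki).
Qed.

Lemma F2_neq0 (a : 'F_2) : (a != 0 -> a = 1)%R.
Proof. by case: a => [[|[|m]] lt_m2] //= _; apply/val_inj. Qed.

(** * Transversals of a nice partition *)

Section NicePartition.
Variables (T : finType) (M : matroid T) (n : nat) (v : T -> 'rV['F_2]_n).
Hypothesis Mv : forall A, indep M A = free [seq v x | x <- enum A].
Hypothesis Mloopless : loopless M.
Variable P : {set {set T}}.
Hypothesis niceP : nice_partition M P.
Implicit Types (A B C F X Y : {set T}) (Q : {set {set T}}) (x y : T).
Implicit Types (g h : {set T} -> T).

Local Notation vspan := (vspan v).

Let partP : partition P [set: T]. Proof. by case: niceP => [[]]. Qed.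

Lemma coverP x : exists2 B, B \in P & x \in B.
Proof. by apply/bigcupP; rewrite -/(cover P) (cover_partition partP). Qed.

Lemma block_eq B C x : B \in P -> C \in P -> x \in B -> x \in C -> B = C.
Proof.
have tiP := partition_trivIset partP; move=> BP CP xB xC.
by rewrite -(def_pblock tiP BP xB) (def_pblock tiP CP xC).
Qed.

Lemma block_neq0 B : B \in P -> B != set0.
Proof. exact: partition_neq0 partP. Qed.

Lemma indep_transversal g Q :
  (forall B, B \in P -> g B \in B) -> Q \subset P -> indep M (g @: Q).
Proof.
move=> gP sQP; apply: (indep_subset (imsetS g sQP)).
case: niceP => [[_ indP] _]; apply: indP; rewrite /is_transversal partP subsetT /=.
apply/forall_inP=> B BP; apply/cards1P; exists (g B); apply/setP=> x.
rewrite !inE; apply/andP/eqP=> [[/imsetP[C CP ->] gCB] | ->].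
  by congr g; apply: block_eq gCB => //; apply: gP.
by rewrite imset_f // gP.
Qed.

Lemma transversal_inj g :
  (forall B, B \in P -> g B \in B) -> {in P &, injective g}.
Proof.
move=> gP B C BP CP eqg; apply: (@block_eq B C (g B)) => //; first exact: gP.
by rewrite eqg gP.
Qed.

Lemma transversal_notin_vspan g Q C :
    (forall B, B \in P -> g B \in B) -> Q \subset P -> C \in P -> C \notin Q ->
  v (g C) \notin vspan (g @: Q).
Proof.
move=> gP sQP CP CQ.
have gCQ : g C \notin g @: Q.
  apply: contra CQ => /imsetP[B QB /(transversal_inj gP)-> //].
  exact: (subsetP sQP).
have := @indep_transversal g (C |: Q) gP; rewrite subUset sub1set CP sQP.
by rewrite imsetU1 (indepU1 Mv) // => /(_ isT)/andP[].
Qed.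

(** The sets [D B] allow the choice to be prescribed in selected blocks. Nonemptiness of [P]
    supplies the default value that a total choice function needs. *)
Lemma exists_transversal (D : {set T} -> {set T}) : P != set0 ->
    (forall B, B \in P -> D B \subset B /\ D B != set0) ->
  exists g, forall B, B \in P -> g B \in D B.
Proof.
case/set0Pn=> B0 /block_neq0/set0Pn[x0 _] DP.
exists (fun B => odflt x0 [pick x in D B]) => B /DP[_ /set0Pn[x Dx]].
by case: pickP => // /(_ x); rewrite Dx.
Qed.

(** * The rank of a flat as the number of blocks it meets *)

(** These blocks index the partition induced on [F]. *)
Definition meeting F : {set {set T}} := [set B in P | B :&: F != set0].

Lemma meeting_sub F : meeting F \subset P.
Proof. by apply/subsetP=> B; rewrite inE => /andP[]. Qed.

Lemma meeting_cover Q : Q \subset P -> meeting (cover Q) = Q.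
Proof.
move=> /subsetP sQP; apply/setP=> B; rewrite inE; apply/andP/idP=> [[BP] | QB].
  case/set0Pn=> x /setIP[Bx /bigcupP[C QC Cx]].
  by rewrite (block_eq BP (sQP C QC) Bx Cx).
split; first exact: sQP.
rewrite (setIidPl _) ?block_neq0 ?sQP //.
exact: bigcup_sup.
Qed.

(** A transversal that picks its elements inside [F] whenever possible has one independent element
    of [F] for each block meeting [F]. *)
Lemma card_meeting_le_rk F : #|meeting F| <= rk M F.
Proof.
have [-> | /set0Pn[B0 mB0]] := eqVneq (meeting F) set0; first by rewrite cards0.
have P0 : P != set0 by apply/set0Pn; exists B0; apply: (subsetP (meeting_sub F)).
have [B BP|g gD] := @exists_transversal
  (fun B => if B :&: F == set0 then B else B :&: F) P0.
  by case: (eqVneq (B :&: F)) => [_ | nBF]; split; rewrite ?subsetIl ?(block_neq0 BP).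
have gP B : B \in P -> g B \in B.
  by move/gD; case: ifP => // _ /setIP[].
have sQP := meeting_sub F.
have sgF : g @: meeting F \subset F.
  apply/subsetP=> _ /imsetP[B mB ->]; move: mB; rewrite inE => /andP[/gD + nBF].
  by rewrite (negPf nBF) => /setIP[].
have := indep_transversal gP sQP; rewrite (indepE Mv).
rewrite card_in_imset => [/eqP<- | ]; first by rewrite (rkE Mv) dimvS ?vspanS.
by move=> B C /(subsetP sQP) BP /(subsetP sQP); apply: transversal_inj.
Qed.

(* A maximal flat [H] of [F] avoiding the element [e] of a singleton induced
   block has corank at most one in [F] and does not meet that block. *)
Lemma rk_flat F : flat M F -> rk M F = #|meeting F|.
Proof.
move=> flF; apply/eqP; rewrite eqn_leq card_meeting_le_rk andbT.
have [m] := ubnP #|F|; elim: m F flF => // m IHm F flF /ltnSE leFm.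
have [-> | F0] := eqVneq F set0; first by rewrite (rkE Mv) vspan0 dimv0.
case: niceP => _ /(_ F flF F0) [B BP /eqP/cards1P[e defe]].
have /setIP[Be Fe] : e \in B :&: F by rewrite defe set11.
have [H /maxsetP[/and3P[/eqP flH sHF eH] maxH] _] :
  {H | maxset (fun X => [&& cl M X == X, X \subset F & e \notin X]) H & set0 \subset H}.
  by apply: maxset_exists; rewrite (loopless_cl0 Mv) // eqxx sub0set inE.
have flatF := flatP Mv _ (introT eqP flF); have flatH := flatP Mv _ (introT eqP flH).
have veH : v e \notin vspan H by apply: contra eH => /flatH.
(* For [x] outside [H], maximality puts [e] in the closure of [x |: H]. The coefficient of [v x] in
   [v e] is nonzero because [v e] is not in the span of [H], so the relation can be solved for
   [v x]. *)
have sF : (vspan F <= <[v e]> + vspan H)%VS.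
  apply/vspan_subvP=> x Fx; have [xH | xH] := boolP (x \in H).
    by apply: subvP (addvSr _ _) _ (mem_vspan v xH).
  have /memv_addP[_ /vlineP[a ->] [w Hw def_e]] : v e \in (<[v x]> + vspan H)%VS.
    rewrite -vspanU1 -(clE Mv); apply: contraNT xH => eX.
    rewrite -[H](maxH (cl M (x |: H))).
    - by rewrite (clE Mv) mem_vspan ?setU11.
    - rewrite (flat_cl Mv) eqxx eX andbT /=; apply/subsetP=> y.
      rewrite (clE Mv) => vy; apply: flatF; apply: subvP vy.
      by apply: vspanS; rewrite subUset sub1set Fx.
    - by apply/subsetP=> y Hy; rewrite (clE Mv) mem_vspan ?setU1r.
  have a1 : a = 1%R.
    by apply: F2_neq0; apply: contraNneq veH => a0; rewrite def_e a0 scale0r add0r.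
  apply/memv_addP; exists (v e); first exact: memv_line.
  exists (- w)%R; first by rewrite memvN.
  by rewrite def_e a1 scale1r addrK.
have ltHF : #|H| < #|F| by apply/proper_card/properP; split=> //; exists e.
have rkF : rk M F <= (rk M H).+1.
  rewrite !(rkE Mv) (leq_trans (dimvS sF)) //.
  by rewrite (leq_trans (dimv_add_leqif _ _).1) // dim_vline -[leqRHS]add1n leq_add2r leq_b1.
apply: leq_trans rkF _; apply: leq_ltn_trans (IHm H flH _) _.
  exact: leq_trans ltHF leFm.
apply/proper_card/properP; split; last first.
  exists B; rewrite !inE BP /=; first by apply/set0Pn; exists e; rewrite defe set11.
  apply/set0Pn=> -[x /setIP[Bx Hx]].
  have : x \in B :&: F by rewrite inE Bx (subsetP sHF).
  by rewrite defe inE => /eqP exe; rewrite -exe Hx in eH.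
apply/subsetP=> C; rewrite !inE => /andP[-> /set0Pn[x /setIP[Cx Hx]]] /=.
by apply/set0Pn; exists x; rewrite inE Cx (subsetP sHF).
Qed.

(** * Lines through two elements of a block, and simplicity *)

Lemma vec_neq0 x : (v x != 0)%R.
Proof. by have := Mloopless x; rewrite (indepE Mv) vspan1 dim_vline cards1 eqb1. Qed.

(** Some transversal contains both [x] and [y], and it is independent. *)
Lemma vec_neq_blocks B C x y :
  B \in P -> C \in P -> x \in B -> y \in C -> B != C -> v x != v y.
Proof.
move=> BP CP Bx Cy nBC.
have P0 : P != set0 by apply/set0Pn; exists B.
have [D DP|g gD] := @exists_transversal
  (fun D => if D == B then [set x] else if D == C then [set y] else D) P0.
  case: eqP => [-> | _]; first by rewrite sub1set -card_gt0 cards1.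
  case: eqP => [-> | _]; first by rewrite sub1set -card_gt0 cards1.
  by rewrite block_neq0.
have gP D : D \in P -> g D \in D.
  by move/gD; case: eqP => [->|_]; [move/set1P->|case: eqP => [->|_//]; move/set1P->].
have gB : g B = x by have := gD B BP; rewrite eqxx => /set1P.
have gC : g C = y by have := gD C CP; rewrite eq_sym (negPf nBC) eqxx => /set1P.
have := @transversal_notin_vspan g [set C] B gP.
rewrite sub1set inE imset_set1 vspan1 gB gC => /(_ CP BP nBC).
by apply: contraNneq => ->; apply: memv_line.
Qed.

(** The block cutting the line in a single element [g] cannot be [B], which contains [e] and [f].
    Now [v g] is nonzero and differs from [v e] and [v f], so over the two-element field only the
    sum remains. Nothing here presupposes [v e != v f], so the lemma can serve to exclude parallel
    elements. *)
Lemma line_meets_other_block B e f : B \in P -> e \in B -> f \in B -> e != f ->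
  exists2 g, g \notin B & v g = (v e + v f)%R.
Proof.
move=> BP Be Bf nef; set L := cl M [set e; f].
have Le : e \in L by rewrite (clE Mv) mem_vspan ?set21.
have Lf : f \in L by rewrite (clE Mv) mem_vspan ?set22.
have L0 : L != set0 by apply/set0Pn; exists e.
case: niceP => _ /(_ L (flat_cl Mv _) L0)[C CP /eqP/cards1P[g defg]].
have /setIP[Cg Lg] : g \in C :&: L by rewrite defg set11.
have nBC : B != C.
  apply: contraNneq nef => BC.
  have : e \in C :&: L by rewrite -BC inE Be.
  have : f \in C :&: L by rewrite -BC inE Bf.
  by rewrite defg !inE => /eqP-> /eqP->.
exists g; first by apply: contra nBC => Bg; rewrite (block_eq BP CP Bg Cg).
move: Lg; rewrite (clE Mv) vspanU1 vspan1.
have ng0 := vec_neq0 g.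
have nge := vec_neq_blocks BP CP Be Cg nBC; have ngf := vec_neq_blocks BP CP Bf Cg nBC.
case/memv_addP=> _ /vlineP[a ->] [_ /vlineP[b ->] defvg]; move: nge ngf ng0; rewrite defvg.
have [-> | /F2_neq0->] := eqVneq a 0%R; have [-> | /F2_neq0->] := eqVneq b 0%R.
- by rewrite !scale0r addr0 eqxx.
- by rewrite scale0r add0r scale1r eqxx.
- by rewrite scale0r addr0 scale1r eqxx.
- by rewrite !scale1r.
Qed.

Lemma F2_addrr (u : 'rV['F_2]_n) : (u + u = 0)%R.
Proof.
by rewrite -mulr2n -scaler_nat (_ : 2%:R = 0 :> 'F_2)%R ?scale0r //; apply/val_inj.
Qed.

(** Elements of different blocks are already separated; for parallel elements of one block, the
    third element of their line would be a loop. *)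
Lemma vec_inj : injective v.
Proof.
move=> x y eqv; apply/eqP; apply: contraT => nxy.
have [B BP Bx] := coverP x; have [C CP Cy] := coverP y.
have [eBC | nBC] := eqVneq B C; last first.
  by have := vec_neq_blocks BP CP Bx Cy nBC; rewrite eqv eqxx.
have [|g _] := line_meets_other_block BP Bx _ nxy; first by rewrite eBC.
by rewrite eqv F2_addrr => g0; have := vec_neq0 g; rewrite g0 eqxx.
Qed.

Lemma nice_simple : simple_matroid M.
Proof.
split=> // x y nxy; rewrite (indepU1 Mv) ?inE // Mloopless andbT vspan1.
apply/negP=> /vlineP[a]; have := vec_neq0 x.
have [-> | /F2_neq0->] := eqVneq a 0%R => nx0 vx.
  by rewrite vx scale0r eqxx in nx0.
by move/eqP: nxy; apply; apply: vec_inj; rewrite vx scale1r.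
Qed.

(** * Deleting a block from a flat union of blocks *)

Lemma cover_setD1 Q B : Q \subset P -> B \in Q -> cover (Q :\ B) = cover Q :\: B.
Proof.
move=> /subsetP sQP QB; apply/setP=> x; apply/bigcupP/setDP.
  case=> C /setD1P[nCB QC] Cx; split; first by apply/bigcupP; exists C.
  by apply: contra nCB => Bx; rewrite (block_eq (sQP C QC) (sQP B QB) Cx Bx).
case=> /bigcupP[C QC Cx] Bx; exists C => //; rewrite !inE QC andbT.
by apply: contraNneq Bx => <-.
Qed.

(** The chosen representatives form a basis of the span of [cover Q]: they are independent, and by
    [rk_flat] their number is its rank. *)
Lemma transversal_coords h Q :
    (forall B, B \in P -> h B \in B) -> Q \subset P -> flat M (cover Q) ->
  exists k : T -> {set T} -> 'F_2, forall x, x \in cover Q ->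
    v x = (\sum_(B in Q) k x B *: v (h B))%R.
Proof.
move=> hP sQP flQ.
have defhQ : vspan (h @: Q) = vspan (cover Q).
  apply/eqP; rewrite eqEdim -!(rkE Mv) (rk_flat flQ) meeting_cover //.
  apply/andP; split.
    apply: vspanS; apply/subsetP=> _ /imsetP[B QB ->]; apply/bigcupP; exists B => //.
    by rewrite hP // (subsetP sQP).
  have := indep_transversal hP sQP; rewrite (indepE Mv) -(rkE Mv) => /eqP->.
  rewrite card_in_imset // => B C /(subsetP sQP) BP /(subsetP sQP).
  exact: transversal_inj.
have shQ : (vspan (h @: Q) <= \sum_(B in Q) <[v (h B)]>)%VS.
  apply/vspan_subvP=> _ /imsetP[B QB ->].
  exact: subvP (sumv_sup B QB (subvv _)) _ (memv_line _).
apply: (@fin_all_exists _ (fun=> {set T} -> 'F_2)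
  (fun x kx => x \in cover Q -> v x = (\sum_(B in Q) kx B *: v (h B))%R)) => x.
have [Qx | _] := boolP (x \in cover Q); last by exists (fun=> 0%R).
have /memv_sumP[u uP ->] : v x \in (\sum_(B in Q) <[v (h B)]>)%VS.
  by apply: subvP shQ _ _; rewrite defhQ mem_vspan.
have [kx kxP] : exists kx : {set T} -> 'F_2, forall B, B \in Q -> u B = (kx B *: v (h B))%R.
  apply: (@fin_all_exists _ (fun=> 'F_2)
    (fun B a => B \in Q -> u B = (a *: v (h B))%R)) => B.
  have [QB | _] := boolP (B \in Q); last by exists 0%R.
  by have /vlineP[a ->] := uP B QB; exists a.
by exists kx => _; apply: eq_bigr.
Qed.

(** If no edge enters [B], all other blocks of [Q] lie in the coordinate hyperplane at [B], which
    the elements of [B] avoid. If every block receives an edge, changing the representatives along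
    chordless cycles produces a dependent transversal. *)
Lemma flat_setD1_block Q : Q \subset P -> Q != set0 -> flat M (cover Q) ->
  exists2 B, B \in Q & flat M (cover (Q :\ B)).
Proof.
move=> sQP Q0 flQ; have flatQ := flatP Mv _ (introT eqP flQ).
have P0 : P != set0 by apply: contraNneq Q0 => P0; rewrite -subset0 -P0.
have [B BP|h hP] := @exists_transversal id P0; first by rewrite (block_neq0 BP).
have [k kP] := transversal_coords hP sQP flQ.
have QP B : B \in Q -> B \in P by apply: subsetP.
have coverQ B x : B \in Q -> x \in B -> x \in cover Q.
  by move=> QB Bx; apply/bigcupP; exists B.
have spanD B x : B \in Q -> x \in cover Q -> k x B = 0%R ->
    v x \in vspan (h @: (Q :\ B)).
  move=> QB Qx kxB; rewrite kP // (bigD1 B) //= kxB scale0r add0r.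
  apply: rpred_sum => C /andP[QC nCB]; apply/rpredZ/mem_vspan/imset_f.
  by rewrite !inE nCB.
(* Exchanging [h B] for [x] gives another transversal, which is again independent. *)
have notin_spanD B x : B \in Q -> x \in B -> v x \notin vspan (h @: (Q :\ B)).
  move=> QB Bx; pose g C := if C == B then x else h C.
  have gP C : C \in P -> g C \in C by rewrite /g; case: eqP => [-> | _ /hP].
  have := @transversal_notin_vspan g (Q :\ B) B gP.
  rewrite (subset_trans (subD1set _ _) sQP) setD11 QP // {1}/g eqxx => /(_ isT isT isT).
  rewrite (@eq_in_imset _ _ g h) // => C; rewrite !inE /g.
  by case: (C == B).
have kdiag B x : B \in Q -> x \in B -> k x B = 1%R.
  move=> QB Bx; apply: F2_neq0; apply: contraNneq (notin_spanD B x QB Bx).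
  by apply: spanD => //; apply: coverQ Bx.
pose e C B := (C != B) && [exists x in C, k x B != 0%R].
have [/existsP[B /andP[QB /forallP noedge]] | all_edge] :=
  boolP [exists B, (B \in Q) && [forall C, (C \in Q) ==> ~~ e C B]].
  exists B => //; apply/eqP/(flatP Mv) => x vx; rewrite cover_setD1 //.
  have vxB : v x \in vspan (h @: (Q :\ B)).
    apply: subvP vx; apply/vspan_subvP=> y; rewrite cover_setD1 //.
    case/setDP=> /bigcupP[C QC Cy] By; apply: spanD => //; first exact: coverQ Cy.
    apply/eqP; apply: contraNT By => ky.
    have := noedge C; rewrite QC /= negb_and negbK => /orP[/eqP<- // |].
    by case/negP; apply/exists_inP; exists y.
  rewrite inE; apply/andP; split.
    by apply: contraL vxB => Bx; apply: notin_spanD.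
  apply: flatQ; apply: subvP vx; apply: vspanS; rewrite cover_setD1 //.
  exact: subsetDl.
have [B QB|S [p [S0 sSQ pS ep uniqp]]] := @exists_chordless_cycles _ e Q Q0.
  move: all_edge; rewrite negb_exists => /forallP/(_ B).
  rewrite QB /= negb_forall => /existsP[C]; rewrite negb_imply negbK => /andP[].
  by exists C.
have inj_p : {in S &, injective p} by apply/imset_injP; rewrite pS.
have SQ B : B \in S -> B \in Q by apply: subsetP.
(* As [p] permutes [S], each [C] in [S] is the predecessor of exactly one [B] in [S]; [f C] is an
   element of [C] witnessing that edge. *)
have [f fP] : exists f : {set T} -> T, forall C, C \in S ->
    f C \in C /\ forall B, B \in S -> p B = C -> k (f C) B != 0%R.
  have [x0 _] := set0Pn _ (block_neq0 (QP _ (SQ _ (xchooseP (set0Pn _ S0))))).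
  apply: (@fin_all_exists _ (fun=> T) (fun C x => C \in S ->
    x \in C /\ forall B, B \in S -> p B = C -> k x B != 0%R)) => C.
  have [SC | _] := boolP (C \in S); last by exists x0.
  move: SC; rewrite -{1}pS => /imsetP[B SB ->].
  have /andP[_ /exists_inP[x px kx]] := ep B SB.
  by exists x => _; split=> // B' SB' /(inj_p _ _ SB' SB)->.
pose g B := if B \in S then f B else h B.
have gP B : B \in P -> g B \in B.
  by rewrite /g; case: ifP => [/fP[] // | _]; apply: hP.
have gSP B : B \in S -> g B = f B by rewrite /g => ->.
pose sigma := (\sum_(C in S) v (g C))%R.
(* Within [S], the coordinate at [B] is nonzero only for the terms at [B] and
   at its unique predecessor [p B], so it cancels in [sigma]. *)
have sigmaE : sigma = (\sum_(B in Q :\: S) (\sum_(C in S) k (f C) B) *: v (g B))%R.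
  transitivity (\sum_(B in Q) (\sum_(C in S) k (f C) B) *: v (h B))%R.
    rewrite /sigma (eq_bigr (fun C => \sum_(B in Q) k (f C) B *: v (h B))%R).
      by rewrite exchange_big; apply: eq_bigr => B _; rewrite scaler_suml.
    move=> C SC; rewrite gSP // kP //.
    by apply: (coverQ C); [apply: SQ | case: (fP C SC)].
  rewrite (big_setID S) /= (setIidPr sSQ) big1 ?add0r => [|B SB].
    by apply: eq_bigr => B /setDP[_ nSB]; rewrite /g (negPf nSB).
  have /andP[npB _] := ep B SB.
  have SpB : p B \in S by rewrite -pS imset_f.
  rewrite (bigD1 B) //= (bigD1 (p B)) ?SpB //= big1 => [|C /andP[/andP[SC nCB] nCp]].
    rewrite kdiag ?SQ //; last by case: (fP B SB).
    have /F2_neq0-> : k (f (p B)) B != 0%R by case: (fP _ SpB) => _; apply.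
    by rewrite addr0 (_ : 1 + 1 = 0 :> 'F_2)%R ?scale0r //; apply/val_inj.
  apply/eqP; apply: contraNT nCp => kC; apply/eqP/uniqp => //.
  rewrite /e nCB; apply/exists_inP; exists (f C) => //.
  by case: (fP C SC).
have [C0 SC0] := set0Pn _ S0.
(* By [sigmaE], [sigma] is a combination of representatives outside [S]. Solving for its term at
   [C0] expresses that term through other blocks of the same transversal. *)
have /negP[] : v (g C0) \notin vspan (g @: (Q :\ C0)).
  apply: transversal_notin_vspan => //; rewrite ?setD11 ?QP ?SQ //.
  exact: subset_trans (subD1set _ _) sQP.
have -> : v (g C0) = (sigma - \sum_(C in S | C != C0) v (g C))%R.
  by rewrite /sigma (bigD1 C0) //= addrK.
apply: rpredB; last first.
  apply: rpred_sum => C /andP[SC nC]; apply/mem_vspan/imset_f.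
  by rewrite !inE nC SQ.
rewrite sigmaE; apply: rpred_sum => C /setDP[QC nSC]; apply/rpredZ/mem_vspan/imset_f.
by rewrite !inE QC andbT; apply: contraNneq nSC => ->.
Qed.

(** * Modularity of the remaining hyperplane, and the chain *)

(** When [X :&: Y] has an element [e] outside [XB], any other such element [f] gives a third element
    on their line, with vector [v e + v f], lying in [XB :&: Y]. So [X :&: Y] is spanned by [e]
    together with [XB :&: Y], and a vector in the span of [XB] cannot involve [e]. *)
Lemma modular_flat_setD1_block Q B : Q \subset P -> B \in Q ->
    flat M (cover (Q :\ B)) -> modular_flat M (cover Q) ->
  modular_flat M (cover (Q :\ B)).
Proof.
move=> sQP QB flQB [flQ modQ]; split=> // Y flY; apply/(modular_pairE Mv).
have flatQ := flatP Mv _ (introT eqP flQ); have flatY := flatP Mv _ (introT eqP flY).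
have flatQB := flatP Mv _ (introT eqP flQB).
have BP : B \in P by apply: (subsetP sQP).
have eQB := cover_setD1 sQP QB.
set XB := cover (Q :\ B) in flQB flatQB eQB *; set X := cover Q in flQ flatQ modQ eQB.
have sXB : XB \subset X by rewrite eQB subsetDl.
have /(modular_pairE Mv) sXY := modQ Y flY.
apply/subvP=> w /memv_capP[wX wY].
have {sXY} wXY : w \in vspan (X :&: Y).
  by apply: subvP sXY _ _; rewrite memv_cap wY (subvP (vspanS v sXB)).
have [sXYB | /subsetPn[e /setIP[Xe Ye] nXBe]] := boolP (X :&: Y \subset XB).
  apply: subvP wXY; apply: vspanS.
  by rewrite subsetI sXYB subsetIr.
have Be : e \in B by move: nXBe; rewrite eQB inE Xe andbT negbK.
have : w \in (<[v e]> + vspan (XB :&: Y))%VS.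
  rewrite -vspanU1; apply: subvP wXY; apply/vspan_subvP=> f /setIP[Xf Yf].
  have [XBf | nXBf] := boolP (f \in XB).
    by rewrite mem_vspan // !inE XBf Yf orbT.
  have Bf : f \in B by move: nXBf; rewrite eQB inE Xf andbT negbK.
  have [<- | nef] := eqVneq e f; first by rewrite mem_vspan ?setU11.
  have [g nBg vg] := line_meets_other_block BP Be Bf nef.
  have Xg : g \in X by apply: flatQ; rewrite vg rpredD ?mem_vspan.
  have Yg : g \in Y by apply: flatY; rewrite vg rpredD ?mem_vspan.
  have -> : v f = (v e + v g)%R by rewrite vg addrA F2_addrr add0r.
  by rewrite rpredD // mem_vspan ?setU11 // !inE eQB inE Xg nBg Yg orbT.
case/memv_addP=> _ /vlineP[a ->] [w' w'XY def_w].
have [a0 | /F2_neq0 a1] := eqVneq a 0%R.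
  by rewrite def_w a0 scale0r add0r.
(* With coefficient one, [v e] is a difference of two vectors in the span of the flat [XB]. *)
case/negP: nXBe; apply: flatQB.
have -> : v e = (w - w')%R by rewrite def_w a1 scale1r addrK.
by rewrite rpredB //; apply: subvP w'XY; apply: vspanS; apply: subsetIl.
Qed.

(** Induction on the number of blocks, peeling them off from the top of the chain; this is why [Q]
    ranges over subfamilies of [P] with a modular union. *)
Lemma nice_chain m Q : #|Q| = m -> Q \subset P -> modular_flat M (cover Q) ->
  exists X : nat -> {set T},
  [/\ X 0 = set0, X m = cover Q, forall i, i < m -> X i \proper X i.+1,
      forall i, i <= m -> modular_flat M (X i) /\ rk M (X i) = i
    & Q = [set X i.+1 :\: X i | i : 'I_m]].
Proof.
elim: m Q => [|m IHm] Q cardQ sQP modQ.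
  have Q0 : Q = set0 by apply/eqP; rewrite -cards_eq0 cardQ.
  have covQ0 : cover Q = set0 by rewrite Q0 /cover big_set0.
  exists (fun=> set0); split=> // [i|].
    rewrite leqn0 => /eqP->; rewrite -covQ0; split=> //.
    by rewrite covQ0 (rkE Mv) vspan0 dimv0.
  by rewrite Q0; apply/esym/eqP; rewrite -subset0; apply/subsetP=> C /imsetP[[i lti0]].
have Q0 : Q != set0 by rewrite -cards_eq0 cardQ.
have [B QB flQB] := flat_setD1_block sQP Q0 modQ.1.
have BP : B \in P by apply: (subsetP sQP).
have modQB := modular_flat_setD1_block sQP QB flQB modQ.
have [||X [X0 Xm propX modX defQB]] := IHm (Q :\ B) _ _ modQB.
- by apply/eqP; rewrite -eqSS -cardQ (cardsD1 B Q) QB.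
- exact: subset_trans (subD1set _ _) sQP.
have sBQ : B \subset cover Q by apply: bigcup_sup.
(* Only index [m.+1] is new: the differences below [m] are kept, and the one at [m] is [B]. *)
exists (fun i => if i == m.+1 then cover Q else X i); rewrite eqxx; split=> //.
- move=> i; rewrite eqSS ltnS => leim; rewrite ltn_eqF ?ltnS //.
  case: eqVneq => [-> | nim]; last by apply: propX; rewrite ltn_neqAle nim.
  rewrite Xm cover_setD1 //; have /set0Pn[x Bx] := block_neq0 BP.
  apply/properP; split; first exact: subsetDl.
  by exists x; rewrite ?(subsetP sBQ) // inE Bx.
- move=> i; case: eqVneq => [-> _ | nim leim].
    by split=> //; rewrite (rk_flat modQ.1) meeting_cover.
  by apply: modX; rewrite -ltnS ltn_neqAle nim.
rewrite -[LHS](setD1K QB) defQB; apply/setP=> C; apply/setU1P/imsetP => [[-> |] | [i _ ->]].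
- exists ord_max => //=; rewrite eqxx ltn_eqF // Xm cover_setD1 //.
  by rewrite setDDr setDv set0U (setIidPr sBQ).
- case/imsetP=> i _ ->; exists (widen_ord (leqnSn m) i) => //=.
  by rewrite eqSS !ltn_eqF // ltnS ltnW.
rewrite eqSS [_ == m.+1]ltn_eqF //; case: eqVneq => [eim | nim].
  by left; rewrite eim Xm cover_setD1 // setDDr setDv set0U (setIidPr sBQ).
have ltim : i < m by rewrite ltn_neqAle nim -ltnS ltn_ord.
by right; apply/imsetP; exists (Ordinal ltim).
Qed.

(** The induction starts from [P] itself: its union is the ground set, a modular flat, and by
    [rk_flat] it has as many blocks as the rank of [M]. *)
Lemma nice_modular_chain : exists X : nat -> {set T},
  [/\ maximal_modular_chain M X, X 0 = set0
    & P = [set X i.+1 :\: X i | i : 'I_(rk M [set: T])]].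
Proof.
have covP := cover_partition partP.
have flT : flat M [set: T].
  by apply/setP=> x; rewrite (clE Mv) mem_vspan ?inE.
have cardP : #|P| = rk M [set: T].
  by rewrite (rk_flat flT) -covP meeting_cover.
have modT : modular_flat M (cover P).
  rewrite covP; split=> // Y _; apply/(modular_pairE Mv).
  by rewrite setTI capvSr.
have [X [X0 Xr propX modX defP]] := nice_chain cardP (subxx _) modT.
exists X; split=> //; split=> //; last by rewrite Xr.
by rewrite (loopless_cl0 Mv).
Qed.

End NicePartition.

Theorem corollary4p2 (T : finType) (M : matroid T)
    (Mloopless : loopless M) (Mbinary : binary M) :
  ((exists P : {set {set T}}, nice_partition M P) <->
     simple_matroid M /\ supersolvable M) /\
  (simple_matroid M /\ supersolvable M ->
   forall P : {set {set T}}, nice_partition M P ->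
   exists X : nat -> {set T},
     [/\ maximal_modular_chain M X, X 0 = set0
       & P = [set X i.+1 :\: X i | i : 'I_(rk M [set: T])]]).
Proof.
have [n [v Mv]] := Mbinary; split; last first.
  by move=> _ P niceP; apply: nice_modular_chain niceP.
split=> [[P niceP] | [simM [X chainX]]].
  split; first exact: nice_simple niceP.
  by have [X [chainX _ _]] := nice_modular_chain Mv Mloopless niceP; exists X.
by eexists; apply: (chain_nice Mv simM chainX).
Qed.
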